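(* Let $\mathbf{X}=\{X_1,\dots,X_K\}$ be real-valued random variables whose joint CDF is represented by a cumulative distribution network, $F(\mathbf{x})=\prod_{c\in\mathcal{C}}\phi_c(\mathbf{x}_c)$. Let $\mathbf{X}_s,\mathbf{X}_t,\mathbf{X}_u\subseteq\mathbf{X}$ be three pairwise disjoint sets of variables such that there is no $c\in\mathcal{C}$ with $\mathbf{X}_c\cap\mathbf{X}_s\neq\emptyset$ and $\mathbf{X}_c\cap\mathbf{X}_t\neq\emptyset$. Suppose that every path in the network between a variable node of $\mathbf{X}_s$ and a variable node of $\mathbf{X}_t$ contains at least one variable node that is not in $\mathbf{X}_s\cup\mathbf{X}_t\cup\mathbf{X}_u$. Then $\mathbf{X}_s$ and $\mathbf{X}_t$ are conditionally independent given $\mathbf{X}_u$: $\mathbf{X}_s\perp\!\!\!\perp\mathbf{X}_t\mid\mathbf{X}_u$.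
   Context: Let $\mathbf{X}=\{X_1,\dots,X_K\}$ be real-valued random variables with joint cumulative distribution function (CDF) $F(\mathbf{x})=\Pr\{X_1\le x_1,\dots,X_K\le x_K\}$, $\mathbf{x}=(x_1,\dots,x_K)$. It is assumed that a joint PDF exists (a density if the variables are continuous, a probability mass function if they are discrete). A cumulative distribution network (CDN) for $\mathbf{X}$ is a bipartite undirected graph with variable nodes $X_1,\dots,X_K$ and finitely many function nodes $c\in\mathcal{C}$. Each function node $c$ carries a function $\phi_c(\mathbf{x}_c)$ of the values $\mathbf{x}_c$ of a subset $\mathbf{X}_c\subseteq\mathbf{X}$, and $c$ is joined by an edge exactly to the variables in $\mathbf{X}_c$. The joint CDF of $\mathbf{X}$ is $F(\mathbf{x})=\prod_{c\in\mathcal{C}}\phi_c(\mathbf{x}_c)$. The functions satisfy $\phi_c(\mathbf{x}_c)\ge 0$ and $\sup_{\mathbf{x}_c}\phi_c(\mathbf{x}_c)=1$ for every $c\in\mathcal{C}$. Paths are paths in this bipartite graph, alternating between variable nodes and function nodes. *)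

(* Defs.v *)
From mathcomp Require Import all_boot all_order all_algebra.
From mathcomp Require Import all_classical all_reals all_analysis.

Set Implicit Arguments.
Unset Strict Implicit.
Unset Printing Implicit Defensive.

Import Order.TTheory GRing.Theory Num.Theory.
Import numFieldNormedType.Exports.

Local Open Scope classical_set_scope.
Local Open Scope ring_scope.

(* The K variables are identified with their indices in 'I_K.  A factor is a
   function of the values of the variables in its scope only.  [sup] is 0 on
   sets that are empty or unbounded above, so [cdn_factor_sup] also says that
   each factor is bounded. *)
Record cdn (R : realType) (K : nat) := CDN {
  cdn_fnode : finType;
  cdn_scope : cdn_fnode -> {set 'I_K};
  cdn_factor : forall c : cdn_fnode, ({i : 'I_K | i \in cdn_scope c} -> R) -> R;
  cdn_factor_ge0 : forall c x, 0 <= @cdn_factor c x;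
  cdn_factor_sup : forall c, sup (range (@cdn_factor c)) = 1 }.

Arguments cdn_factor {R K} N c x : rename.

Definition cdn_restr (R : realType) (K : nat) (A : {set 'I_K})
    (x : K.-tuple R) : {i : 'I_K | i \in A} -> R :=
  fun i => tnth x (val i).

Definition cdn_prod (R : realType) (K : nat) (N : cdn R K) (x : K.-tuple R) : R :=
  \prod_(c : cdn_fnode N) cdn_factor N c (cdn_restr x).

Definition cdn_node (R : realType) (K : nat) (N : cdn R K) : finType :=
  ('I_K + cdn_fnode N)%type.

Definition cdn_edge (R : realType) (K : nat) (N : cdn R K) : rel (cdn_node N) :=
  fun a b => match a, b with
  | inl i, inr c => i \in cdn_scope c
  | inr c, inl i => i \in cdn_scope c
  | _, _ => false
  end.

(* [v :: p] is a path (without repeated nodes) from [v] to [w]. *)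
Definition cdn_path (R : realType) (K : nat) (N : cdn R K) (v w : cdn_node N)
    (p : seq (cdn_node N)) : Prop :=
  [/\ path.path (@cdn_edge R K N) v p, uniq (v :: p) & last v p = w].

Definition rv_vec (d : measure_display) (T : measurableType d) (R : realType)
    (P : probability T R) (K : nat) (X : 'I_K -> {RV P >-> R}) (w : T) : K.-tuple R :=
  [tuple X i w | i < K].

Definition joint_cdf (d : measure_display) (T : measurableType d) (R : realType)
    (P : probability T R) (K : nat) (X : 'I_K -> {RV P >-> R}) (x : K.-tuple R)
    : \bar R :=
  P [set w | forall i : 'I_K, X i w <= tnth x i].

(* Lebesgue integral over R^n of a nonnegative Borel function, written as an
   iterated integral (Tonelli). *)
Fixpoint integral_tuple (R : realType) (n : nat) : (n.-tuple R -> \bar R) -> \bar R :=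
  match n with
  | 0 => fun f => f [tuple]
  | m.+1 => fun f =>
      (\int[@lebesgue_measure R]_y
         integral_tuple (fun t : m.-tuple R => f [tuple of y :: t]))%E
  end.

Definition is_joint_density (d : measure_display) (T : measurableType d)
    (R : realType) (P : probability T R) (K : nat) (X : 'I_K -> {RV P >-> R})
    (f : K.-tuple R -> R) : Prop :=
  [/\ forall y, 0 <= f y,
      measurable_fun [set: K.-tuple R] f &
      forall B : set (K.-tuple R), measurable B ->
        P (rv_vec X @^-1` B) = integral_tuple (fun y => (f y * \1_B y)%:E)].

Definition is_joint_pmf (d : measure_display) (T : measurableType d)
    (R : realType) (P : probability T R) (K : nat) (X : 'I_K -> {RV P >-> R})
    (p : K.-tuple R -> R) : Prop :=
  (forall y, P (rv_vec X @^-1` [set y]) = (p y)%:E) /\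
  (\esum_(y in [set: K.-tuple R]) (p y)%:E = 1)%E.

Definition has_joint_pdf (d : measure_display) (T : measurableType d)
    (R : realType) (P : probability T R) (K : nat) (X : 'I_K -> {RV P >-> R})
    : Prop :=
  (exists f, is_joint_density X f) \/ (exists p, is_joint_pmf X p).

Definition sigma_rv (d : measure_display) (T : measurableType d) (R : realType)
    (P : probability T R) (K : nat) (X : 'I_K -> {RV P >-> R}) (A : {set 'I_K})
    : set (set T) :=
  <<s \bigcup_(i in [set` A]) preimage_set_system [set: T] (X i) measurable >>.

(* [f] is a version of the conditional probability P(E | G), for a
   sub-sigma-algebra G. *)
Definition is_cond_prob (d : measure_display) (T : measurableType d)
    (R : realType) (P : probability T R) (G : set (set T)) (E : set T)
    (f : T -> R) : Prop :=
  [/\ preimage_set_system [set: T] f (measurable : set (set R)) `<=` G,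
      P.-integrable [set: T] (EFin \o f) &
      forall H, G H -> (\int[P]_(w in H) (f w)%:E = P (E `&` H))%E].

(* P(A & B | X_u) = P(A | X_u) P(B | X_u) almost surely, for all A in
   sigma(X_s) and B in sigma(X_t). *)
Definition cond_indep (d : measure_display) (T : measurableType d)
    (R : realType) (P : probability T R) (K : nat) (X : 'I_K -> {RV P >-> R})
    (s t u : {set 'I_K}) : Prop :=
  forall A B, sigma_rv X s A -> sigma_rv X t B ->
  exists a b ab : T -> R,
    [/\ is_cond_prob P (sigma_rv X u) A a,
        is_cond_prob P (sigma_rv X u) B b,
        is_cond_prob P (sigma_rv X u) (A `&` B) ab &
        {ae P, forall w, ab w = a w * b w}].

(* Main.v *)
Require Import Defs.
From HB Require Import structures.
From mathcomp Require Import all_boot all_order all_algebra.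
From mathcomp Require Import all_classical all_reals all_analysis.
From mathcomp Require Import measurable_realfun.
Import Order.TTheory GRing.Theory Num.Theory.
Import numFieldNormedType.Exports.
Set Implicit Arguments.
Unset Strict Implicit.

Local Open Scope classical_set_scope.
Local Open Scope ring_scope.

(** Sending the variables outside [s :|: t :|: u] to infinity disconnects [s] from [t]:
    [s :|: t :|: u] splits into disjoint [U] containing [s] and [V] containing [t] such
    that no scope meets both.  The single factors need not converge in this limit, but
    exchanging factors gives, for every [n],
    [F(x_U, x_V, n) F(n, n, n) = F(x_U, n, n) F(n, x_V, n)], and only values of the CDF
    occur here.  Letting [n] tend to infinity, X_U and X_V are independent.  If [a] and
    [b] are versions of P(A | X_(u :&: U)) and P(B | X_(u :&: V)), it follows that [a],
    [b] and [a * b] are versions of P(A | X_u), P(B | X_u) and P(A & B | X_u). *)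

(** * Independent set systems and products of integrals *)

Section probability.
Context d (T : measurableType d) (R : realType) (P : probability T R).
Implicit Types (G : set (set T)) (A B E F H : set T).

Definition indep_systems G1 G2 :=
  forall A B, G1 A -> G2 B -> P (A `&` B) = (P A * P B)%E.

Lemma indep_systemsC G1 G2 : indep_systems G1 G2 -> indep_systems G2 G1.
Proof. by move=> h A B hA hB; rewrite setIC h// muleC. Qed.

Lemma g_sigma_measurable G : G `<=` measurable -> <<s G >> `<=` measurable.
Proof. by apply: smallest_sub; exact: sigma_algebra_measurable. Qed.

(** Dynkin's pi-lambda uniqueness. Since [G] contains [setT], the constant sequence [setT] serves as
    the exhausting sequence. *)
Lemma measure_unique_g_sigma G (m1 m2 : {measure set T -> \bar R}) :
  G `<=` measurable -> setI_closed G -> G setT -> (m1 setT < +oo)%E ->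
  (forall A, G A -> m1 A = m2 A) -> forall A, <<s G >> A -> m1 A = m2 A.
Proof.
move=> mG GI GT fin m12 A sA.
apply: (g_sigma_algebra_measure_unique G mG (fun=> setT)) => //.
by rewrite bigcup_const.
Qed.

(** For fixed [B] in [G2], the maps sending [A] to [P (A & B)] and to [P A * P B] are finite
    measures that agree on the pi-system [G1]. *)
Lemma indep_g_sigma_l G1 G2 :
  G1 `<=` measurable -> setI_closed G1 -> G1 setT -> G2 `<=` measurable ->
  indep_systems G1 G2 -> indep_systems <<s G1 >> G2.
Proof.
move=> mG1 G1I G1T mG2 h A B sA GB.
have p0 : (0 <= fine (P B))%R by exact: fine_ge0.
pose m1 := mrestr P (mG2 _ GB).
pose m2 := mscale (NngNum p0) P.
have m2E C : m2 C = (P C * P B)%E.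
  by rewrite /m2 /mscale /= fineK 1?muleC// fin_num_measure//; exact: (mG2 _ GB).
rewrite -m2E; apply: (@measure_unique_g_sigma G1 m1 m2) => //.
- rewrite /m1 /= /mrestr setTI; apply: le_lt_trans (probability_le1 _ _) _ => //; first exact: (mG2 _ GB).
  exact: ltry.
- by move=> C GC; rewrite /m1 /= /mrestr h// -m2E.
Qed.

Lemma indep_g_sigma G1 G2 :
  G1 `<=` measurable -> setI_closed G1 -> G1 setT ->
  G2 `<=` measurable -> setI_closed G2 -> G2 setT ->
  indep_systems G1 G2 -> indep_systems <<s G1 >> <<s G2 >>.
Proof.
move=> mG1 G1I G1T mG2 G2I G2T h.
apply: indep_g_sigma_l => //; first exact: g_sigma_measurable.
by apply/indep_systemsC/indep_g_sigma_l => //; exact/indep_systemsC.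
Qed.

(** By uniqueness of the product measure, the law of [(X, Y)] is the product of the two laws;
    Tonelli then splits the integral. Nonnegativity replaces integrability. *)
Lemma indep_integralM d1 d2 (T1 : measurableType d1) (T2 : measurableType d2)
    (X : {RV P >-> T1}) (Y : {RV P >-> T2}) (f : T1 -> \bar R) (g : T2 -> \bar R) :
  (forall (A : set T1) (B : set T2), measurable A -> measurable B ->
    P (X @^-1` A `&` Y @^-1` B) = (P (X @^-1` A) * P (Y @^-1` B))%E) ->
  measurable_fun [set: T1] f -> measurable_fun [set: T2] g ->
  (forall x, 0 <= f x)%E -> (forall y, 0 <= g y)%E ->
  (\int[P]_w (f (X w) * g (Y w)) = \int[P]_w f (X w) * \int[P]_w g (Y w))%E.
Proof.
move=> XY mf mg f0 g0.
have mXY : measurable_fun setT (fun w => (X w, Y w)).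
  by apply: measurable_fun_pair.
pose Z : {RV P >-> (T1 * T2)%type} :=
  HB.pack (fun w => (X w, Y w)) (isMeasurableFun.Build _ _ _ _ _ mXY).
pose h (z : T1 * T2) := (f z.1 * g z.2)%E.
have mh : measurable_fun setT h.
  by apply: emeasurable_funM; apply: measurableT_comp.
have h0 z : (0 <= h z)%E by exact: mule_ge0.
transitivity (\int[distribution P Z]_z h z)%E.
  by rewrite ge0_integral_distribution.
transitivity (\int[distribution P X \x distribution P Y]_z h z)%E.
  apply: eq_measure_integral => A mA _; apply/esym.
  apply: (@product_measure_unique _ _ _ _ _ (distribution P X) (distribution P Y)
    (distribution P Z)) => //.
rewrite fubini_tonelli1//= /fubini_F.
transitivity (\int[distribution P X]_x (f x * \int[distribution P Y]_y g y))%E.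
  apply: eq_integral => x _; rewrite /h /= ge0_integralZl//.
rewrite ge0_integralZr//; last exact: integral_ge0.
by rewrite !ge0_integral_distribution.
Qed.

Lemma preimage_sub_measurable_fun G (f : T -> R) :
  preimage_set_system setT f measurable `<=` <<s G >> <->
  measurable_fun (setT : set (g_sigma_algebraType G)) f.
Proof.
split=> [h _ B mB|h _ [B mB <-]]; last exact: h.
by apply: h; exists B.
Qed.

Lemma id_measurable G : G `<=` measurable ->
  measurable_fun setT (id : T -> g_sigma_algebraType G).
Proof. by move=> mG _ A mA; rewrite setTI; exact: g_sigma_measurable mA. Qed.

(** Viewed as a random variable with values in [T] under the coarser sigma-algebra, the identity has
    as its law the restriction of [P] to [<<s G >>]. *)
Definition id_RV G (mG : G `<=` measurable) : {RV P >-> g_sigma_algebraType G} :=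
  HB.pack (id : T -> g_sigma_algebraType G)
    (isMeasurableFun.Build _ _ _ _ _ (id_measurable mG)).

(** * Existence of conditional probabilities *)

Section cond_prob_exists.
Variables (G : set (set T)) (E : set T).
Hypotheses (mG : G `<=` measurable) (mE : measurable E).

(** The argument is typed over [g_sigma_algebraType G] so that [nu] becomes a measure on the
    sub-sigma-algebra, where the density has to be taken. *)
Let nu (H : g_sigma_algebraType G -> Prop) : \bar R := mrestr P mE H.

Let nu0 : nu set0 = 0%E. Proof. exact: measure0. Qed.

Let nu_ge0 H : (0 <= nu H)%E. Proof. exact: measure_ge0. Qed.

Let nu_sigma_additive : semi_sigma_additive nu.
Proof.
move=> F mF tF mUF; apply: (@measure_semi_sigma_additive _ _ _ (mrestr P mE)) => //.
- by move=> i; exact: g_sigma_measurable (mF i).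
- exact: g_sigma_measurable mUF.
Qed.

HB.instance Definition _ := isMeasure.Build _ _ _ nu nu0 nu_ge0 nu_sigma_additive.

Let nu_finite : fin_num_fun nu.
Proof.
move=> H mH; rewrite /nu /mrestr fin_num_measure//.
by apply: measurableI => //; exact: g_sigma_measurable mH.
Qed.

HB.instance Definition _ := Measure_isFinite.Build _ _ _ nu nu_finite.

(** The version is the Radon-Nikodym derivative of [nu] with respect to [P] restricted to
    [<<s G >>]. Its pointwise nonnegativity is kept because products of versions are later
    integrated by Tonelli. *)
Lemma cond_prob_exists :
  exists2 f, is_cond_prob P <<s G >> E f & forall w, 0 <= f w.
Proof.
pose Z := id_RV mG.
pose mu := distribution P Z.
have dom : nu `<< mu.
  apply/null_content_dominatesP => H mH.
  rewrite /mu /distribution /pushforward /nu /mrestr /= => PH0.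
  apply/eqP; rewrite -measure_le0 -PH0.
  have mH' : measurable (H : set T) by exact: g_sigma_measurable mH.
  by rewrite le_measure ?inE//; exact: measurableI.
have [f [f0 ffin intf fE]] := radon_nikodym_sigma_finite dom.
have mf := measurable_int _ intf.
have fK : EFin \o (fine \o f) = f by apply/funext => w /=; rewrite fineK.
exists (fine \o f); last by move=> w; exact: fine_ge0.
split.
- by apply/preimage_sub_measurable_fun; exact: measurableT_comp.
- rewrite fK; apply/integrableP; split.
    exact: (measurableT_comp mf (id_measurable mG)).
  move/integrableP : intf => [_].
  by rewrite ge0_integral_distribution//; exact: measurableT_comp.
- move=> H sH.
  rewrite setIC; transitivity (\int[mu]_(w in H) f w)%E; last exact/esym/fE.
  rewrite /mu /distribution ge0_integral_pushforward//.
  + by apply: eq_integral => w _ /=; rewrite fineK.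
  + exact: measurable_funTS.
Qed.
End cond_prob_exists.

(** * Product rule for conditional probabilities *)

Section integral_measure.
Variable f : T -> \bar R.
Hypotheses (mf : measurable_fun [set: T] f) (f0 : forall w, (0 <= f w)%E).

Let nu A : \bar R := (\int[P]_(w in A) f w)%E.

Let nu0 : nu set0 = 0%E. Proof. exact: integral_set0. Qed.

Let nu_ge0 A : (0 <= nu A)%E. Proof. exact: integral_ge0. Qed.

Let nu_sigma_additive : semi_sigma_additive nu.
Proof. exact: semi_sigma_additive_nng_induced. Qed.

HB.instance Definition _ := isMeasure.Build _ _ _ nu nu0 nu_ge0 nu_sigma_additive.

(** The indefinite integral of [f] is itself a measure, so uniqueness on a pi-system applies; it is
    finite because it agrees with [m] on [setT]. *)
Lemma integral_unique G (m : {measure set T -> \bar R}) :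
  G `<=` measurable -> setI_closed G -> G setT -> (m setT < +oo)%E ->
  (forall A, G A -> (\int[P]_(w in A) f w = m A)%E) ->
  forall A, <<s G >> A -> (\int[P]_(w in A) f w = m A)%E.
Proof.
move=> mG GI GT mT h A sA.
by apply: (@measure_unique_g_sigma G nu m) => //; rewrite /= /nu h.
Qed.
End integral_measure.

(** Independence gives the defining identity on the sets [H1 & H2] with [H1] in [<<s G1 >>] and [H2]
    in [<<s G2 >>]; these form a pi-system generating [<<s G1]|[G2 >>]. *)
Lemma cond_probM G1 G2 S1 S2 E F (a b : T -> R) :
  G1 `<=` measurable -> G2 `<=` measurable ->
  S1 `<=` measurable -> S2 `<=` measurable ->
  <<s G1 >> `<=` <<s S1 >> -> <<s G2 >> `<=` <<s S2 >> ->
  indep_systems <<s S1 >> <<s S2 >> ->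
  <<s S1 >> E -> <<s S2 >> F ->
  is_cond_prob P <<s G1 >> E a -> is_cond_prob P <<s G2 >> F b ->
  (forall w, 0 <= a w) -> (forall w, 0 <= b w) ->
  is_cond_prob P <<s G1 `|` G2 >> (E `&` F) (fun w => a w * b w).
Proof.
move=> mG1 mG2 mS1 mS2 GS1 GS2 ind sE sF [ma ia aE] [mb ib bF] a0 b0.
have mgen : G1 `|` G2 `<=` measurable by move=> ? [/mG1|/mG2].
have mE : measurable E by exact: g_sigma_measurable sE.
have mF : measurable F by exact: g_sigma_measurable sF.
have ma' := (preimage_sub_measurable_fun _ _).1 ma.
have mb' := (preimage_sub_measurable_fun _ _).1 mb.
have mab : measurable_fun (setT : set (g_sigma_algebraType (G1 `|` G2)))
    (fun w => a w * b w).
  apply: measurable_funM.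
    move=> mT B mB; apply: (sub_sigma_algebra2 (@subsetUl _ G1 G2)).
    exact: ma'.
  move=> mT B mB; apply: (sub_sigma_algebra2 (@subsetUr _ G1 G2)).
  exact: mb'.
have mabT : measurable_fun [set: T] (fun w => (a w * b w)%:E).
  apply/measurable_EFinP.
  exact: (measurableT_comp mab (id_measurable mgen)).
(* Both sides factor: the integral through the restrictions of [a] to [H1] and of [b] to [H2], the
   probability after regrouping into [E & H1] and [F & H2]. *)
have key H1 H2 : <<s G1 >> H1 -> <<s G2 >> H2 ->
    (\int[P]_(w in H1 `&` H2) (a w * b w)%:E = P ((E `&` F) `&` (H1 `&` H2)))%E.
  move=> sH1 sH2; rewrite integral_mkcond.
  pose f : g_sigma_algebraType G1 -> \bar R := (EFin \o a) \_ H1.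
  pose g : g_sigma_algebraType G2 -> \bar R := (EFin \o b) \_ H2.
  have mf : measurable_fun setT f.
    apply/(measurable_restrictT _ _).1 => //.
    by apply: measurable_funTS; exact/measurable_EFinP.
  have mg : measurable_fun setT g.
    apply/(measurable_restrictT _ _).1 => //.
    by apply: measurable_funTS; exact/measurable_EFinP.
  have f0 w : (0 <= f w)%E by rewrite /f patchE; case: ifP => //=; rewrite lee_fin.
  have g0 w : (0 <= g w)%E by rewrite /g patchE; case: ifP => //=; rewrite lee_fin.
  rewrite setIACA ind; last 2 first.
  - exact: (@measurableI _ (g_sigma_algebraType S1) _ _ sE (GS1 _ sH1)).
  - exact: (@measurableI _ (g_sigma_algebraType S2) _ _ sF (GS2 _ sH2)).
  rewrite -aE// -bF// [X in (_ = X * _)%E]integral_mkcond.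
  rewrite [X in (_ = _ * X)%E]integral_mkcond.
  rewrite -(@indep_integralM _ _ _ _ (id_RV mG1) (id_RV mG2) f g)//; last first.
    by move=> A B mA mB; apply: ind; [exact: GS1|exact: GS2].
  apply: eq_integral => w _.
  rewrite /f /g !patchE in_setI /=.
  by case: (w \in H1); case: (w \in H2); rewrite /= ?mule0 ?mul0e.
have sT G : <<s G >> setT := @measurableT _ (g_sigma_algebraType G).
have PEFT : (P (E `&` F) < +oo)%E.
  by apply: le_lt_trans (probability_le1 _ _) (ltry _); exact: measurableI.
have ab0 w : 0 <= a w * b w by exact: mulr_ge0.
split.
- exact/preimage_sub_measurable_fun.
- apply/integrableP; split=> //.
  under eq_integral do rewrite gee0_abs ?lee_fin//.
  (* Taking [H1 = H2 = setT], the total integral is [P (E & F)], hence finite. *)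
  by have := key _ _ (sT G1) (sT G2); rewrite !setIT => ->.
- move=> H sH.
  pose GI := [set A `&` B | A in <<s G1 >> & B in <<s G2 >>].
  rewrite setIC; apply: (@integral_unique _ mabT _ GI
    (mrestr P (measurableI _ _ mE mF))) => //.
  + by move=> _ [A sA [B sB <-]]; apply: measurableI;
      [exact: g_sigma_measurable sA|exact: g_sigma_measurable sB].
  + move=> _ _ [A sA [B sB <-]] [A' sA' [B' sB' <-]]; rewrite setIACA.
    exists (A `&` A'); first exact: (@measurableI _ (g_sigma_algebraType G1)).
    by exists (B `&` B') => //; exact: (@measurableI _ (g_sigma_algebraType G2)).
  + by exists setT => //; exists setT => //; rewrite setIT.
  + by rewrite /= /mrestr setTI.
  + by move=> _ [A sA [B sB <-]]; rewrite key// /= /mrestr setIC.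
  (* A generator from [G1] or [G2] is a set of [GI] whose other component is [setT]. *)
  + apply: sub_sigma_algebra2 sH => A [GA|GA].
      by exists A; [exact: sub_sigma_algebra|exists setT => //; rewrite setIT].
    by exists setT => //; exists A; [exact: sub_sigma_algebra|rewrite setTI].
Qed.
End probability.

(** * Random vectors: conditional independence and orthants *)

Section random_vectors.
Context d (T : measurableType d) (R : realType) (P : probability T R).
Variables (K : nat) (X : 'I_K -> {RV P >-> R}).
Implicit Types (J U s t u : {set 'I_K}) (x y : 'I_K -> R).

Definition rv_system U : set (set T) :=
  \bigcup_(i in [set` U]) preimage_set_system [set: T] (X i) measurable.

Lemma rv_system_measurable U : rv_system U `<=` measurable.
Proof. by move=> _ [i _ [B mB <-]]; exact: measurable_funPT. Qed.

Lemma rv_systemS U U' : U \subset U' -> rv_system U `<=` rv_system U'.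
Proof. by move=> /fintype.subsetP UU' A [i Ui Xi]; exists i => //; exact: UU'. Qed.

Lemma rv_systemU U U' : rv_system (U :|: U') = rv_system U `|` rv_system U'.
Proof.
apply/seteqP; split=> [A [i /= + XA]|A].
  by rewrite finset.inE => /orP[Ui|Ui]; [left|right]; exists i.
by move=> [|]; apply: rv_systemS; rewrite (finset.subsetUl, finset.subsetUr).
Qed.

(** Conditioning on [u] amounts to conditioning on [u1] inside [U] and [u2] inside [V] together, so
    all three versions come from the product rule. *)
Lemma indep_cond_indep (U V s t u : {set 'I_K}) :
  indep_systems P (sigma_rv X U) (sigma_rv X V) ->
  s \subset U -> t \subset V -> u \subset U :|: V ->
  cond_indep X s t u.
Proof.
move=> ind sU tV uUV A B sA sB.
set u1 := u :&: U; set u2 := u :&: V.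
have uE : rv_system u = rv_system u1 `|` rv_system u2.
  by rewrite -rv_systemU -finset.setIUr; congr rv_system; apply/esym/finset.setIidPl.
have mR := rv_system_measurable.
have sA' : <<s rv_system U >> A by apply: sub_sigma_algebra2 sA; exact: rv_systemS.
have sB' : <<s rv_system V >> B by apply: sub_sigma_algebra2 sB; exact: rv_systemS.
have mA : measurable A by exact: g_sigma_measurable sA'.
have mB : measurable B by exact: g_sigma_measurable sB'.
have [a aP a0] := cond_prob_exists P (mR u1) mA.
have [b bP b0] := cond_prob_exists P (mR u2) mB.
(* The constant 1 is a version for the event [setT]. Pairing it with [a] or [b] turns a version
   given [u1] or [u2] alone into one given [u]. *)
have oneP G : G `<=` measurable -> is_cond_prob P <<s G >> setT (fun=> 1).
  move=> mG; split.
  - by apply/preimage_sub_measurable_fun; exact: measurable_cst.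
  - exact: finite_measure_integrable_cst.
  - move=> H sH; rewrite integral_cst ?mul1e ?setTI//.
    exact: g_sigma_measurable sH.
have sT G : <<s G >> setT := @measurableT _ (g_sigma_algebraType G).
have prod E F e f : <<s rv_system U >> E -> <<s rv_system V >> F ->
    is_cond_prob P <<s rv_system u1 >> E e -> is_cond_prob P <<s rv_system u2 >> F f ->
    (forall w, 0 <= e w) -> (forall w, 0 <= f w) ->
    is_cond_prob P (sigma_rv X u) (E `&` F) (fun w => e w * f w).
  move=> sE sF eP fP e0 f0.
  rewrite /sigma_rv -/(rv_system u) uE.
  apply: (cond_probM (mR u1) (mR u2) (mR U) (mR V)) => //.
  - by apply: sub_sigma_algebra2; apply: rv_systemS; exact: finset.subsetIr.
  - by apply: sub_sigma_algebra2; apply: rv_systemS; exact: finset.subsetIr.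
exists (fun w => a w * 1), (fun w => 1 * b w), (fun w => a w * b w); split.
- by rewrite -(setIT A); apply: prod => //; exact: oneP.
- by rewrite -(setTI B); apply: prod => //; exact: oneP.
- exact: prod.
- by apply: aeW => w; rewrite mulr1 mul1r.
Qed.

Definition orthant J x : set T := [set w | forall i, i \in J -> X i w <= x i].

Lemma measurable_orthant J x : measurable (orthant J x).
Proof.
have -> : orthant J x = \bigcap_(i in [set` J]) (X i @^-1` `]-oo, x i]).
  apply/seteqP; split=> w /= h i Ji; first by rewrite /= in_itv /=; exact: h.
  by have := h i Ji; rewrite /= in_itv.
apply: fin_bigcap_measurable => [|i _]; first exact: finite_finset.
by rewrite -[X in measurable X]setTI; exact: measurable_funP.
Qed.

(** Since [J] ranges over all subsets of [U], the system contains [setT] (empty [J]) and the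
    one-variable events (singletons), besides being closed under intersection. *)
Definition orthants U : set (set T) :=
  [set A | exists2 J : {set 'I_K}, J \subset U & exists x, A = orthant J x].

Lemma orthants_measurable U : orthants U `<=` measurable.
Proof. by move=> _ [J _ [x ->]]; exact: measurable_orthant. Qed.

Lemma orthants_setI U : setI_closed (orthants U).
Proof.
move=> _ _ [J JU [x ->]] [L LU [y ->]].
exists (J :|: L); first by rewrite /= finset.subUset JU.
exists (fun i => if i \in J then if i \in L then Num.min (x i) (y i) else x i
                 else y i).
apply/esym/seteqP; split=> w.
  move=> h; split=> i Ji.
    have := h i; rewrite finset.inE Ji => /(_ isT).
    by case: ifP => // _; rewrite le_min => /andP[].
  have := h i; rewrite finset.inE Ji orbT => /(_ isT).
  by case: ifP => // _; rewrite le_min => /andP[].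
move=> [hx hy] i; rewrite finset.inE; case: ifPn => /= [Ji _|_]; last exact: hy.
by case: ifPn => [Li|_]; rewrite ?le_min hx ?hy.
Qed.

Lemma orthant0 x : orthant finset.set0 x = setT.
Proof. by apply/seteqP; split=> // w _ i; rewrite finset.inE. Qed.

Lemma orthants_setT U : orthants U setT.
Proof.
by exists finset.set0; [exact: finset.sub0set|exists (fun=> 0); rewrite ?orthant0].
Qed.

(** The rays []r, +oo[] generate the Borel sets, and their preimages are complements of one-variable
    orthants. *)
Lemma sigma_rv_orthants U : sigma_rv X U `<=` <<s orthants U >>.
Proof.
apply: smallest_sub; first exact: smallest_sigma_algebra.
move=> _ [i /= Ui [B mB <-]].
have mXi : measurable_fun (setT : set (g_sigma_algebraType (orthants U))) (X i).
  apply: (measurability _ (RGenOInfty.measurableE R)).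
  move=> _ [_ [r ->] <-]; rewrite setTI.
  have -> : X i @^-1` `]r, +oo[ = ~` orthant [set i]%SET (fun=> r).
    apply/seteqP; split=> w /=.
      rewrite in_itv /= andbT => rX /(_ i).
      by rewrite finset.inE eqxx leNgt rX => /(_ isT).
    move=> h; rewrite in_itv /= andbT ltNge; apply/negP => Xr; apply: h => j.
    by rewrite finset.inE => /eqP ->.
  apply: (@measurableC _ (g_sigma_algebraType (orthants U))).
  apply: sub_sigma_algebra; exists [set i]%SET; first by rewrite /= finset.sub1set.
  by exists (fun=> r).
exact: mXi.
Qed.

Lemma indep_orthants U V :
  indep_systems P (orthants U) (orthants V) ->
  indep_systems P (sigma_rv X U) (sigma_rv X V).
Proof.
move=> h A B /sigma_rv_orthants sA /sigma_rv_orthants sB.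
by apply: (@indep_g_sigma _ _ _ P (orthants U) (orthants V)) => //;
  [exact: orthants_measurable|exact: orthants_setI|exact: orthants_setT
  |exact: orthants_measurable|exact: orthants_setI|exact: orthants_setT].
Qed.

(* As [n] grows, the coordinates outside [J] are marginalised out. *)
Definition trunc_at J x (n : nat) : 'I_K -> R :=
  fun i => if i \in J then x i else n%:R.

(** Continuity of [P] from below along an increasing union. *)
Lemma orthant_cvg J x :
  P (orthant [set: 'I_K]%SET (trunc_at J x n)) @[n --> \oo] --> P (orthant J x).
Proof.
pose F n := orthant [set: 'I_K]%SET (trunc_at J x n).
have -> : orthant J x = \bigcup_n F n.
  apply/seteqP; split=> w.
    (* A natural number above every coordinate of the sample; [Num.trunc] is 0 on negative reals, so
       its successor is still an upper bound there. *)
    move=> h; exists (\max_(i < K) (Num.trunc (X i w)).+1)%N => // i _.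
    rewrite /trunc_at; case: ifPn => [/h//|_].
    apply/ltW/(lt_le_trans (y := (Num.trunc (X i w)).+1%:R)).
      by rewrite -truncn_le_nat.
    by rewrite ler_nat (leq_bigmax (F := fun i => (Num.trunc (X i w)).+1)).
  move=> [n _ h] i Ji; have := h i; rewrite /trunc_at Ji; apply.
  by rewrite finset.inE.
apply: nondecreasing_cvg_mu.
- by move=> n; exact: measurable_orthant.
- by apply: bigcupT_measurable => n; exact: measurable_orthant.
- move=> m n mn; apply/subsetPset => w h i Ti; apply: le_trans (h i Ti) _.
  by rewrite /trunc_at; case: ifP => // _; rewrite ler_nat.
Qed.

End random_vectors.

(** * Factorisation of the CDF of a network *)

Section cdn_independence.
Context d (T : measurableType d) (R : realType) (P : probability T R).
Variables (K : nat) (X : 'I_K -> {RV P >-> R}) (N : cdn R K).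
Implicit Types (J L U V s t u : {set 'I_K}) (x y : 'I_K -> R).

(** The identity holds factor by factor: a scope missing [J] cannot tell [J :|: L] from [L], nor the
    empty set from [J], and symmetrically for a scope missing [L]. *)
Lemma cdn_prod_trunc_at J L x n :
  (forall c : cdn_fnode N,
    [disjoint cdn_scope c & J] || [disjoint cdn_scope c & L]) ->
  cdn_prod N (mktuple (trunc_at (J :|: L) x n)) *
    cdn_prod N (mktuple (trunc_at finset.set0 x n)) =
  cdn_prod N (mktuple (trunc_at J x n)) * cdn_prod N (mktuple (trunc_at L x n)).
Proof.
move=> h; rewrite /cdn_prod -!big_split/=; apply: eq_bigr => c _.
have restrE (U V : {set 'I_K}) : {in cdn_scope c, U =i V} ->
    cdn_restr (A := cdn_scope c) (mktuple (trunc_at U x n)) =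
    cdn_restr (mktuple (trunc_at V x n)).
  move=> UV; apply/funext => i; rewrite /cdn_restr !tnth_mktuple /trunc_at.
  by rewrite UV//; exact: valP.
case/orP: (h c) => dis; have dis0 i : i \in cdn_scope c -> _ :=
  disjointFr dis (x := i).
- rewrite (restrE (J :|: L) L) 1?(restrE finset.set0 J) 1?mulrC// => i ci;
  by rewrite !finset.inE dis0.
- rewrite (restrE (J :|: L) J) 1?(restrE finset.set0 L)// => i ci;
  by rewrite !finset.inE dis0 ?orbF.
Qed.

Hypothesis hcdn : forall x : K.-tuple R, joint_cdf X x = (cdn_prod N x)%:E.

Lemma orthant_joint_cdf x :
  P (orthant X [set: 'I_K]%SET x) = (cdn_prod N (mktuple x))%:E.
Proof.
rewrite -hcdn /joint_cdf; congr (P _); apply/seteqP.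
split=> w h i; last by move=> _; have := h i; rewrite tnth_mktuple.
by have := h i; rewrite tnth_mktuple finset.inE => /(_ isT).
Qed.

Lemma cdn_prod_cvg J x :
  cdn_prod N (mktuple (trunc_at J x n)) @[n --> \oo] --> fine (P (orthant X J x)).
Proof.
have fin : P (orthant X J x) \is a fin_num.
  by rewrite fin_num_measure//; exact: measurable_orthant.
have := @orthant_cvg _ _ _ P _ X J x; rewrite -[X in _ --> X](fineK fin).
under eq_fun do rewrite orthant_joint_cdf.
exact: fine_cvg.
Qed.

Lemma indep_disjoint_scopes U V :
  [disjoint U & V]%B ->
  (forall c : cdn_fnode N,
    [disjoint cdn_scope c & U] || [disjoint cdn_scope c & V]) ->
  indep_systems P (sigma_rv X U) (sigma_rv X V).
Proof.
move=> UV h; apply: indep_orthants => _ _ [J JU [x ->]] [L LV [y ->]].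
(* Disjointness of [J] and [L] allows one point to carry both families of bounds. *)
pose z i := if i \in J then x i else y i.
have JL i : i \in L -> i \in J = false.
  by move=> /(fintype.subsetP LV) iV; apply/negP => /(fintype.subsetP JU);
    rewrite (disjointFl UV).
have -> : orthant X J x = orthant X J z.
  by apply/seteqP; split=> w k i iJ; have := k i iJ; rewrite /z iJ.
have -> : orthant X L y = orthant X L z.
  by apply/seteqP; split=> w k i iL; have := k i iL; rewrite /z JL.
have -> : orthant X J z `&` orthant X L z = orthant X (J :|: L) z.
  apply/seteqP; split=> w.
    by move=> [k1 k2] i; rewrite finset.inE => /orP[]; [exact: k1|exact: k2].
  by move=> k; split=> i iJ; apply: k; rewrite finset.inE iJ ?orbT.
(* For the empty set every coordinate tends to infinity, so the second factor tends to 1. *)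
have := cvgM (@cdn_prod_cvg (J :|: L) z) (@cdn_prod_cvg finset.set0 z).
rewrite orthant0 probability_setT/= mulr1 => /(_ _) l1.
have := cvgM (@cdn_prod_cvg J z) (@cdn_prod_cvg L z) => /(_ _) l2.
have fP J' : (fine (P (orthant X J' z)))%:E = P (orthant X J' z).
  by rewrite fineK// fin_num_measure//; exact: measurable_orthant.
rewrite -(fP (J :|: L)) -(fP J) -(fP L) -EFinM; congr (_%:E).
(* The two limits coincide because the sequences are equal term by term. *)
rewrite -(cvg_lim _ l1)// -(cvg_lim _ l2)//; congr (lim (_ @ \oo)).
apply/funext => n /=; apply: cdn_prod_trunc_at => c.
have [k|k] := orP (h c); apply/orP; [left|right].
  exact: disjointWr JU k.
exact: disjointWr LV k.
Qed.

End cdn_independence.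

(** * Separation in the network graph *)

Section cdn_separation.
Variables (R : realType) (K : nat) (N : cdn R K).
Implicit Types (s t u U V : {set 'I_K}).

(** In the graph whose variable nodes are restricted to [s :|: t :|: u], [U] collects the connected
    components meeting [s], and [V] is the rest. *)
Lemma cdn_separation s t u :
  (forall (i j : 'I_K) (p : seq (cdn_node N)),
    i \in s -> j \in t -> cdn_path (inl i) (inl j) p ->
    exists k : 'I_K, (inl k : cdn_node N) \in (inl i : cdn_node N) :: p /\
      k \notin s :|: t :|: u) ->
  exists U V, [/\ U :|: V = s :|: t :|: u, [disjoint U & V]%B,
    s \subset U, t \subset V & forall c : cdn_fnode N,
      [disjoint cdn_scope c & U] || [disjoint cdn_scope c & V]].
Proof.
move=> hsep; set W := s :|: t :|: u.
pose ok (v : cdn_node N) := if v is inl k then k \in W else true.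
pose e : rel (cdn_node N) := fun v w => [&& cdn_edge v w, ok v & ok w].
pose U := [set k in W | [exists i in s, connect e (inl i) (inl k)]]%SET.
exists U, (W :\: U).
have UW : U \subset W by apply/fintype.subsetP => k; rewrite finset.inE => /andP[].
split.
- by rewrite -[RHS](finset.setID W U) (finset.setIidPr UW).
- by rewrite finset.disjoints_subset; apply/fintype.subsetP => k kU;
    rewrite !finset.inE in kU *; rewrite kU.
- apply/fintype.subsetP => i si; rewrite !finset.inE si /=.
  by apply/existsP; exists i; rewrite si connect0.
- apply/fintype.subsetP => j tj; rewrite !finset.inE tj orbT /= andbT.
  apply/existsP => -[i /andP[si /connectP[p ep]]].
  (* A node of [t] reached from [s] would give a walk inside [W]; shortening it makes its nodes
     distinct, as [cdn_path] demands, and contradicts the separation. *)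
  case: (shortenP ep) => q eq uq _ jq.
  have [|k [kq kW]] := hsep i j q si tj.
    split=> //; apply: sub_path eq => v w; by case/and3P.
  suff /allP /(_ _ kq) : all ok (inl i :: q) by rewrite /= (negbTE kW).
  have : ok (inl i) by rewrite /ok !finset.inE si.
  elim: q (inl i : cdn_node N) {uq kq jq} eq => [|w q IH] v /=; first by rewrite andbT.
  by move=> /andP[/and3P[_ _ okw] pq] -> /=; exact: IH.
(* If the scope of [c] met [U] at [i] and [V] at [j], the steps from [i] to [c] to [j] would make
   [j] reachable from [s], hence a member of [U]. *)
- move=> c; apply/negPn/negP; rewrite negb_or -!finset.setI_eq0.
  move=> /andP[/finset.set0Pn[i]]; rewrite finset.inE => /andP[ci iU].
  move=> /finset.set0Pn[j]; rewrite finset.inE => /andP[cj jV].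
  move: iU; rewrite finset.inE => /andP[iW /existsP[k /andP[sk ki]]].
  move: jV; rewrite finset.in_setD [j \in U]finset.inE => /andP[+ jW].
  rewrite jW /= => /negP; apply; apply/existsP; exists k; rewrite sk /=.
  apply: connect_trans ki _; apply: (@connect_trans _ _ (inr c)); apply: connect1.
    by rewrite /e /= ci iW.
  by rewrite /e /= cj jW.
Qed.

End cdn_separation.

Theorem mainTheorem2 (d : measure_display) (T : measurableType d) (R : realType)
    (P : probability T R) (K : nat) (X : 'I_K -> {RV P >-> R}) (N : cdn R K)
    (s t u : {set 'I_K})
    (hpdf : has_joint_pdf X)
    (hcdn : forall x : K.-tuple R, joint_cdf X x = (cdn_prod N x)%:E)
    (hst : s :&: t = finset.set0) (hsu : s :&: u = finset.set0)
    (htu : t :&: u = finset.set0)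
    (hnoc : ~ exists c : cdn_fnode N,
        cdn_scope c :&: s <> finset.set0 /\ cdn_scope c :&: t <> finset.set0)
    (hsep : forall (i j : 'I_K) (p : seq (cdn_node N)),
        i \in s -> j \in t -> cdn_path (inl i) (inl j) p ->
        exists k : 'I_K,
          (inl k : cdn_node N) \in (inl i : cdn_node N) :: p /\
          k \notin s :|: t :|: u) :
  cond_indep X s t u.
Proof.
have [U [V [UV disUV sU tV scopes]]] := cdn_separation hsep.
apply: (indep_cond_indep (indep_disjoint_scopes hcdn disUV scopes)) => //.
by rewrite UV finset.subsetUr.
Qed.
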